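(* Let $f$ be any newform with integer coefficients and weight $2k \in \{12, 14, 18, 20\}$, with Fourier coefficients $a_f(n)$. Then for every prime $p$, $$ a_f(p^4) \notin \{ \pm 31, \pm 59, \pm 61, \pm 79, \pm 101, \pm 139, \pm 149, \pm 151, \pm 179, \pm 191, \pm 199, \pm 19^2 \}. $$
   Context: A newform of weight $2k$ and level $N$ means a normalized ($a_f(1)=1$) cuspidal newform on $\Gamma_0(N)$ (trivial nebentypus), with Fourier expansion $f(z) = q + \sum_{n\ge 2} a_f(n) q^n$, $q = e^{2\pi i z}$. *)

(* Defs.v *)
From Stdlib Require Import Reals ZArith Znumtheory Arith List.
From Coquelicot Require Import Coquelicot.

Open Scope C_scope.

Definition upper_half_plane (z : C) : Prop := (0 < Im z)%R.

Definition Csum {A : Type} (l : list A) (F : A -> C) : C :=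
  fold_right (fun x s => F x + s) (RtoC 0) l.

(* e(z) = exp(2 pi i z), in real and imaginary parts. *)
Definition cis2pi (z : C) : C :=
  ((exp (- (2 * PI * Im z)) * cos (2 * PI * Re z))%R,
   (exp (- (2 * PI * Im z)) * sin (2 * PI * Re z))%R).

Record mat2 : Set := Mat2 { m11 : Z; m12 : Z; m21 : Z; m22 : Z }.

Definition det2 (g : mat2) : Z := (m11 g * m22 g - m12 g * m21 g)%Z.

Definition mul2 (g h : mat2) : mat2 :=
  Mat2 (m11 g * m11 h + m12 g * m21 h)%Z (m11 g * m12 h + m12 g * m22 h)%Z
       (m21 g * m11 h + m22 g * m21 h)%Z (m21 g * m12 h + m22 g * m22 h)%Z.

(* The inverse when the determinant is 1. *)
Definition inv2 (g : mat2) : mat2 := Mat2 (m22 g) (- m12 g) (- m21 g) (m11 g).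

Definition SL2Z (g : mat2) : Prop := det2 g = 1%Z.

Definition Gamma0 (N : nat) (g : mat2) : Prop :=
  SL2Z g /\ (Z.of_nat N | m21 g)%Z.

Definition moebius (g : mat2) (z : C) : C :=
  (IZR (m11 g) * z + IZR (m12 g)) / (IZR (m21 g) * z + IZR (m22 g)).

Definition slash (w : nat) (f : C -> C) (g : mat2) (z : C) : C :=
  f (moebius g z) / (IZR (m21 g) * z + IZR (m22 g)) ^ w.

Definition holomorphic_on_H (f : C -> C) : Prop :=
  forall z, upper_half_plane z ->
    ex_derive (K := C_AbsRing) (V := C_NormedModule) f z.

(* f(z) = sum_{n >= 0} a(n) e(z/h)^n on the upper half-plane. *)
Definition fourier_expansion (h : nat) (f : C -> C) (a : nat -> C) : Prop :=
  forall z, upper_half_plane z ->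
    is_series (K := C_AbsRing) (V := C_NormedModule)
      (fun n => a n * cis2pi (z / INR h) ^ n) (f z).

(* Every g^-1 Gamma0(N) g with g in SL2(Z) contains the translation by N, so
   f|g has an expansion in e(z/N) whatever the width of the cusp. *)
Record cusp_form (w N : nat) (f : C -> C) : Prop := {
  cusp_form_holomorphic : holomorphic_on_H f;
  cusp_form_invariant : forall g, Gamma0 N g ->
    forall z, upper_half_plane z -> slash w f g z = f z;
  cusp_form_cuspidal : forall g, SL2Z g ->
    exists b : nat -> C, b 0%nat = 0 /\ fourier_expansion N (slash w f g) b
}.

(* Representatives of the right cosets Gamma0(N) \ SL2(Z). *)
Definition coset_reps (N : nat) (s : list mat2) : Prop :=
  NoDup s /\ (forall g, In g s -> SL2Z g) /\
  (forall g, SL2Z g -> exists! r, In r s /\ Gamma0 N (mul2 g (inv2 r))).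

(* Integral of phi for dx dy / y^2 over the standard fundamental domain
   { |x| <= 1/2, x^2 + y^2 >= 1 } of SL2(Z). *)
Definition integral_fundamental_domain (phi : C -> R) : R :=
  RInt (fun x : R =>
          RInt_gen (fun y : R => (phi (x, y) / y ^ 2)%R)
                   (at_point (sqrt (1 - x ^ 2))) (Rbar_locally p_infty))
       (- (1 / 2))%R (1 / 2)%R.

(* The Petersson product of level N is the integral of
   f(z) conj(g(z)) Im(z)^w dx dy / y^2 over the union of the translates of the
   standard fundamental domain by s, a set of representatives of
   Gamma0(N) \ SL2(Z). It is not normalized by the volume. *)
Definition petersson (w : nat) (s : list mat2) (f g : C -> C) : C :=
  let phi z := f z * Cconj (g z) * RtoC (Im z ^ w) in
  Csum s (fun r =>
    (integral_fundamental_domain (fun z => Re (phi (moebius r z))),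
     integral_fundamental_domain (fun z => Im (phi (moebius r z))))).

(* The value of the product does not depend on s. *)
Definition petersson_orthogonal (w N : nat) (f g : C -> C) : Prop :=
  forall s, coset_reps N s -> petersson w s f g = 0.

(* The old subspace of level N is spanned by the z |-> g(d z) with g a cusp
   form of level M and d M | N, M < N; the new subspace is its orthogonal
   complement in the space of cusp forms of level N. *)
Definition in_new_subspace (w N : nat) (f : C -> C) : Prop :=
  cusp_form w N f /\
  forall (M d : nat) (g : C -> C),
    Nat.divide (d * M) N -> (M < N)%nat -> cusp_form w M g ->
    petersson_orthogonal w N f (fun z => g (INR d * z)).

(* T_n f(z) = n^(w-1) sum_{a d = n, gcd(a, N) = 1} sum_{0 <= b < d}
                d^(-w) f((a z + b) / d),
   which for n = p prime dividing N is the operator U_p. *)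
Definition hecke (w N n : nat) (f : C -> C) (z : C) : C :=
  INR n ^ (w - 1) *
  Csum (filter (fun a => (n mod a =? 0)%nat && (Nat.gcd a N =? 1)%nat)%bool
               (seq 1 n))
    (fun a => let d := (n / a)%nat in
       Csum (seq 0 d) (fun b => f ((INR a * z + INR b) / INR d) / INR d ^ w)).

Definition hecke_eigenform (w N : nat) (f : C -> C) : Prop :=
  forall n, (1 <= n)%nat -> exists lambda : C,
    forall z, upper_half_plane z -> hecke w N n f z = lambda * f z.

Record newform (w N : nat) (f : C -> C) (a : nat -> C) : Prop := {
  newform_new : in_new_subspace w N f;
  newform_eigenform : hecke_eigenform w N f;
  newform_fourier : fourier_expansion 1 f a;
  newform_normalized : a 1%nat = 1
}.

(* Main.v *)
Require Import Defs.
From Stdlib Require Import Reals ZArith Znumtheory Zpow_facts Arith List Lia Lra.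
From Coquelicot Require Import Coquelicot.
Import ListNotations.
Local Open Scope C_scope.

(** Write q = 2k - 1, so q is 11, 13, 17 or 19, and A = a(p).

    Comparing Fourier coefficients in T_p f = lambda f (for p dividing N this
    is U_p f = lambda f) gives lambda = A and
    [a(p m) + x a(m / p) = A a(m)], where [x] is p^q if p is prime to N and 0
    otherwise, and where a vanishes off the integers.  Hence [a(p^4) = A^4 - 3 A^2 x + x^2], which is
    [coefficient_prime_fourth].  The comparison is legitimate because a
    holomorphic function on the upper half-plane has at most one Fourier
    expansion, and the restriction to the imaginary axis, where the expansion
    is a real power series on (0, 1), already shows this ([fourier_unique]).

    It remains to see that [y^2 - 3 y x + x^2], with [y = A^2] and [x = b^q],
    never equals l or -l ([quartic_form_avoids]); the case of p dividing N is
    b = 0.  The form is the norm of [y - phi^2 x] from Z[phi], phi the golden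
    ratio, so the elements of norm l or -l are, up to sign, finitely many
    elements times the powers of phi.  In coordinates, y and x are the terms of index n and
    n + 2, in one of the two orders, of a Fibonacci-type sequence K whose
    first two terms come from a short explicit list ([norm_form_orbit]).  A
    Fibonacci-type sequence is periodic modulo any r.  For each l and each
    starting pair, a few moduli r together show that, for every residue of n
    modulo a common period M, one of the two terms fails to be a square
    modulo some r or the other fails to be a q-th power modulo that r.
    A solution with b = 0 or b = 1 would survive every congruence, and such a
    sieve can succeed only because there is none for the listed values l. *)

(** * Power series vanishing on (0, 1) *)

(** The series converges at 1/2, so its sum is continuous at 0, where it takes
    the value [c 0]; the limit from the right is 0.  Only this side of 0 is
    available, because e(z) is positive on the imaginary axis. *)
Lemma is_pseries_zero_head (c : nat -> R) :
  (forall t : R, (0 < t < 1)%R -> is_pseries c t 0%R) -> c 0%nat = 0%R.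
Proof.
  intros h.
  assert (hcv : Rbar_lt (Rabs 0) (CV_radius c)).
  { apply Rbar_lt_le_trans with (Rabs (1 / 2)).
    - rewrite Rabs_R0, Rabs_pos_eq; simpl; lra.
    - destruct (Rbar_le_lt_dec (Rabs (1 / 2)) (CV_radius c)) as [hle | hlt]; [exact hle|].
      exfalso. destruct (CV_disk_outside c (1 / 2) hlt).
      apply is_lim_seq_ext with (fun n => scal (pow_n (1 / 2)%R n) (c n)).
      { intros n. rewrite pow_n_pow. apply Rmult_comm. }
      apply ex_series_lim_0. exists 0%R. apply (h (1 / 2)%R). lra. }
  pose proof (PSeries_continuity c 0 hcv) as hc.
  rewrite <- (PSeries_0 c).
  apply continuity_pt_filterlim in hc.
  apply (filterlim_locally_unique (F := at_right 0) (PSeries c)).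
  - intros P hP. apply hc in hP. unfold filtermap in *.
    destruct hP as [e he]. exists e. intros t ht _. now apply he.
  - apply filterlim_ext_loc with (fun _ => 0%R); [|apply filterlim_const].
    exists (mkposreal 1 Rlt_0_1). intros t ht ht0. symmetry.
    apply is_pseries_unique, h. split; [exact ht0|].
    change (Rabs (t - 0) < 1)%R in ht. apply Rabs_def2 in ht. lra.
Qed.

Lemma is_pseries_zero_coeff (c : nat -> R) :
  (forall t : R, (0 < t < 1)%R -> is_pseries c t 0%R) -> forall n, c n = 0%R.
Proof.
  intros h n. revert c h. induction n as [|n IH]; intros c h.
  - now apply is_pseries_zero_head.
  - apply (IH (PS_decr_1 c)). intros t ht.
    replace 0%R with (/ t * (0 + - c 0%nat))%R
      by (rewrite is_pseries_zero_head by easy; ring).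
    apply (is_pseries_decr_1 (K := R_AbsRing) (V := R_NormedModule) c t (/ t)%R);
      [|now apply h].
    change (/ t * t = 1)%R. apply Rinv_l. lra.
Qed.

(** * Series of complex numbers *)

Local Notation is_Cseries := (is_series (K := C_AbsRing) (V := C_NormedModule)).

Lemma is_series_additive (g : C -> R) (u : nat -> C) (s : C) :
  (forall z w : C, g (z + w) = (g z + g w)%R) ->
  continuous (T := C_UniformSpace) (U := R_UniformSpace) g s ->
  is_Cseries u s -> is_series (fun n => g (u n)) (g s).
Proof.
  intros hadd hcont h.
  apply filterlim_ext with (fun n => g (sum_n (G := C_AbelianMonoid) u n)).
  { intros n. induction n as [|n IH].
    - now rewrite !sum_O.
    - rewrite !sum_Sn, <- IH. apply hadd. }
  exact (filterlim_comp _ _ _ _ _ _ _ _ h hcont).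
Qed.

Lemma is_series_Re (u : nat -> C) (s : C) :
  is_Cseries u s -> is_series (fun n => Re (u n)) (Re s).
Proof.
  apply is_series_additive; [reflexivity|]. destruct s as [x y].
  exact (continuous_fst (U := R_UniformSpace) (V := R_UniformSpace) x y).
Qed.

Lemma is_series_Im (u : nat -> C) (s : C) :
  is_Cseries u s -> is_series (fun n => Im (u n)) (Im s).
Proof.
  apply is_series_additive; [reflexivity|]. destruct s as [x y].
  exact (continuous_snd (U := R_UniformSpace) (V := R_UniformSpace) x y).
Qed.

Lemma is_Cseries_Csum {A : Type} (l : list A) (u : A -> nat -> C) (s : A -> C) :
  (forall i, is_Cseries (u i) (s i)) ->
  is_Cseries (fun n => Csum l (fun i => u i n)) (Csum l s).
Proof.
  intros h. induction l as [|i l IH]; simpl.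
  - apply filterlim_ext with (fun _ => RtoC 0); [|apply filterlim_const].
    intros n. induction n as [|n IH]; [now rewrite sum_O|].
    rewrite sum_Sn, <- IH. symmetry. apply Cplus_0_r.
  - exact (is_series_plus _ _ _ _ (h i) IH).
Qed.

Definition spread {A : Type} (z : A) (d : nat) (u : nat -> A) (m : nat) : A :=
  if (m mod d =? 0)%nat then u (m / d)%nat else z.

(** Substituting Q^d for Q in a power series: the series in Q^d becomes a
    series in Q whose coefficients vanish off the multiples of d. *)
Lemma is_series_spread {K : AbsRing} {V : NormedModule K} (d : nat) (u : nat -> V) (s : V) :
  (0 < d)%nat -> is_series u s -> is_series (spread zero d u) s.
Proof.
  intros hd h.
  apply filterlim_ext with (fun m => sum_n u (m / d)).
  { intros m. induction m as [|m IH].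
    - rewrite sum_O. unfold spread. rewrite Nat.Div0.mod_0_l, Nat.Div0.div_0_l. simpl. apply sum_O.
    - rewrite sum_Sn, <- IH. unfold spread.
      pose proof (Nat.div_mod_eq (S m) d) as e.
      pose proof (Nat.mod_upper_bound (S m) d ltac:(lia)) as hb.
      destruct (Nat.eqb_spec (S m mod d) 0) as [e0 | ne].
      + rewrite e0 in e. destruct (S m / d)%nat as [|k]; [lia|].
        replace (m / d)%nat with k; [apply sum_Sn|].
        apply Nat.div_unique with (d - 1)%nat; lia.
      + rewrite plus_zero_r. f_equal.
        generalize dependent (S m mod d)%nat. intros r e hb ne.
        apply Nat.div_unique with (r - 1)%nat; lia. }
  apply filterlim_comp with (2 := h).
  intros P [n hn]. exists (n * d)%nat. intros m hm. apply hn.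
  now apply Nat.div_le_lower_bound; [lia | rewrite Nat.mul_comm].
Qed.

(** * The exponential e(z) and roots of unity *)

Lemma cis2pi_plus (z w : C) : cis2pi (z + w) = cis2pi z * cis2pi w.
Proof.
  unfold cis2pi, Cmult, Cplus, Re, Im. cbn [fst snd].
  rewrite !Rmult_plus_distr_l, Ropp_plus_distr, exp_plus, cos_plus, sin_plus.
  f_equal; ring.
Qed.

Lemma cis2pi_0 : cis2pi 0 = 1.
Proof.
  unfold cis2pi. simpl. rewrite !Rmult_0_r, Ropp_0, exp_0, cos_0, sin_0. now rewrite !Rmult_1_l.
Qed.

Lemma cis2pi_pow (z : C) (n : nat) : cis2pi z ^ n = cis2pi (INR n * z).
Proof.
  induction n as [|n IH].
  - simpl. rewrite Cmult_0_l. now rewrite cis2pi_0.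
  - rewrite Cpow_S, IH, <- cis2pi_plus, S_INR, RtoC_plus. f_equal. ring.
Qed.

Lemma cis2pi_INR (n : nat) : cis2pi (INR n) = 1.
Proof.
  rewrite <- (Cmult_1_r (INR n)), <- cis2pi_pow.
  unfold cis2pi. simpl. rewrite Rmult_0_r, Ropp_0, exp_0, Rmult_1_r, cos_2PI, sin_2PI.
  rewrite Rmult_1_r, Rmult_0_r. apply Cpow_1_l.
Qed.

Lemma cis2pi_imaginary (y : R) : cis2pi (0, y) = exp (- (2 * PI * y))%R.
Proof.
  unfold cis2pi. simpl. rewrite Rmult_0_r, cos_0, sin_0. now rewrite Rmult_1_r, Rmult_0_r.
Qed.

Lemma INR_neq0 (n : nat) : (0 < n)%nat -> RtoC (INR n) <> 0.
Proof. intros h e. apply RtoC_inj in e. apply lt_INR in h. simpl in h. lra. Qed.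

(** Primitivity of the p-th roots of unity, read off the real part by
    [cos (2 u) = 1 - 2 (sin u)^2]. *)
Lemma cis2pi_ratio_eq_1 (n p : nat) :
  (0 < p)%nat -> cis2pi (INR n / INR p) = 1 -> Nat.divide p n.
Proof.
  intros hp h.
  pose proof (lt_0_INR p hp) as hp'.
  rewrite <- RtoC_div in h by lra.
  apply (f_equal Re) in h. unfold cis2pi in h. simpl in h.
  rewrite Rmult_0_r, Ropp_0, exp_0, Rmult_1_l in h.
  replace (2 * PI * (INR n / INR p))%R with (2 * (PI * (INR n / INR p)))%R in h by ring.
  rewrite cos_2a_sin in h.
  assert (hs : sin (PI * (INR n / INR p)) = 0%R) by nra.
  apply sin_eq_0_0 in hs. destruct hs as [k hk].
  assert (e : INR n = (IZR k * INR p)%R).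
  { apply Rmult_eq_reg_l with PI; [|apply PI_neq0].
    apply Rmult_eq_reg_r with (/ INR p)%R; [|apply Rinv_neq_0_compat; lra].
    transitivity (IZR k * PI)%R; [rewrite <- hk|]; field; lra. }
  rewrite !INR_IZR_INZ, <- mult_IZR in e. apply eq_IZR in e.
  exists (Z.to_nat k). nia.
Qed.

Lemma Csum_geometric (r : C) (n : nat) :
  (r - 1) * Csum (seq 0 n) (fun b => r ^ b) = r ^ n - 1.
Proof.
  assert (h : forall m, (r - 1) * Csum (seq m n) (fun b => r ^ b) = r ^ (n + m) - r ^ m).
  { induction n as [|n IH]; intros m; simpl; [ring|].
    rewrite Cmult_plus_distr_l, IH, Nat.add_succ_r. simpl. ring. }
  rewrite h, Nat.add_0_r. reflexivity.
Qed.

Lemma Csum_ext {A : Type} (l : list A) (F G : A -> C) :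
  (forall i, F i = G i) -> Csum l F = Csum l G.
Proof. intros h. induction l as [|i l IH]; simpl; [easy | now rewrite h, IH]. Qed.

Lemma Csum_scal {A : Type} (l : list A) (c : C) (F : A -> C) :
  Csum l (fun i => c * F i) = c * Csum l F.
Proof. induction l as [|i l IH]; simpl; [ring | rewrite IH; ring]. Qed.

Lemma Csum_roots_of_unity (p n : nat) :
  (0 < p)%nat ->
  Csum (seq 0 p) (fun b => cis2pi (INR b / INR p) ^ n) =
  if (n mod p =? 0)%nat then INR p else 0.
Proof.
  intros hp. pose proof (INR_neq0 p hp) as hp0.
  rewrite Csum_ext with (G := fun b => cis2pi (INR n / INR p) ^ b).
  2:{ intros b. rewrite !cis2pi_pow. f_equal. now field. }
  pose proof (Csum_geometric (cis2pi (INR n / INR p)) p) as hg.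
  rewrite cis2pi_pow in hg.
  replace (INR p * (INR n / INR p)) with (RtoC (INR n)) in hg by now field.
  rewrite cis2pi_INR in hg.
  destruct (Nat.eqb_spec (n mod p) 0) as [e | ne].
  - apply Nat.Div0.mod_divides in e. destruct e as [k ->].
    rewrite mult_INR, RtoC_mult.
    replace (INR p * INR k / INR p) with (RtoC (INR k)) by now field.
    rewrite cis2pi_INR. clear.
    rewrite Csum_ext with (G := fun _ => 1 * 1) by (intros b; rewrite Cpow_1_l; ring).
    generalize 0%nat. induction p as [|p IH]; intros m; [easy|].
    cbn [seq Csum fold_right]. fold (Csum (seq (S m) p) (fun _ => 1 * 1)).
    rewrite IH, S_INR, RtoC_plus. ring.
  - assert (hr : cis2pi (INR n / INR p) - 1 <> 0).
    { intros e. apply ne, Nat.Lcm0.mod_divide, cis2pi_ratio_eq_1; [easy|].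
      rewrite <- (Cplus_0_l 1), <- e. ring. }
    set (S := Csum _ _) in *.
    replace S with (((cis2pi (INR n / INR p) - 1) * S) / (cis2pi (INR n / INR p) - 1)) by now field.
    rewrite hg. now field.
Qed.

(** * Fourier expansions *)

(** On z = i h y the exponential e(z/h) runs through the reals t of (0, 1), so
    the real and imaginary parts of the coefficients are those of two real
    power series that vanish on (0, 1). *)
Lemma fourier_zero (h : nat) (c : nat -> C) :
  (0 < h)%nat -> fourier_expansion h (fun _ => 0) c -> forall n, c n = 0.
Proof.
  intros hh hc n. pose proof (lt_0_INR h hh) as hh'. pose proof (INR_neq0 h hh) as hh0.
  pose proof PI_RGT_0 as hpi.
  assert (hs : forall t : R, (0 < t < 1)%R ->
    is_Cseries (fun m => c m * RtoC (t ^ m)) (RtoC 0)).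
  { intros t ht.
    set (y := (- ln t / (2 * PI))%R).
    assert (hy : (0 < y)%R).
    { apply Rdiv_lt_0_compat; [|lra]. pose proof (ln_increasing t 1 (proj1 ht) (proj2 ht)) as hl.
      rewrite ln_1 in hl. lra. }
    assert (hH : upper_half_plane (INR h * (0, y))%C).
    { unfold upper_half_plane. simpl. rewrite Rmult_0_l, Rplus_0_r. now apply Rmult_lt_0_compat. }
    eapply is_series_ext; [|exact (hc _ hH)]. intros m. cbv beta. f_equal.
    assert (e : forall w : C, INR h * w / INR h = w) by (intros w; now field).
    rewrite e, cis2pi_imaginary, <- RtoC_pow. do 3 f_equal.
    replace (- (2 * PI * y))%R with (ln t) by (unfold y; field; lra).
    now apply exp_ln. }
  assert (hre : Re (c n) = 0%R).
  { apply (is_pseries_zero_coeff (fun m => Re (c m))). intros t ht.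
    eapply is_series_ext; [|exact (is_series_Re _ _ (hs t ht))].
    intros m. rewrite pow_n_pow. destruct (c m) as [x y]. cbv [Re RtoC Cmult scal fst snd].
    simpl. unfold mult; simpl. ring. }
  assert (him : Im (c n) = 0%R).
  { apply (is_pseries_zero_coeff (fun m => Im (c m))). intros t ht.
    eapply is_series_ext; [|exact (is_series_Im _ _ (hs t ht))].
    intros m. rewrite pow_n_pow. destruct (c m) as [x y]. cbv [Im RtoC Cmult scal fst snd].
    simpl. unfold mult; simpl. ring. }
  apply injective_projections; [exact hre | exact him].
Qed.

Lemma fourier_ext (h : nat) (F G : C -> C) (c : nat -> C) :
  (forall z, upper_half_plane z -> F z = G z) ->
  fourier_expansion h F c -> fourier_expansion h G c.
Proof. intros e hF z hz. rewrite <- (e z hz). exact (hF z hz). Qed.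

Lemma fourier_plus (h : nat) (F G : C -> C) (c d : nat -> C) :
  fourier_expansion h F c -> fourier_expansion h G d ->
  fourier_expansion h (fun z => F z + G z) (fun n => c n + d n).
Proof.
  intros hF hG z hz.
  eapply is_series_ext; [|exact (is_series_plus _ _ _ _ (hF z hz) (hG z hz))].
  intros n. cbv beta. symmetry. apply Cmult_plus_distr_r.
Qed.

Lemma fourier_scal (h : nat) (r : C) (F : C -> C) (c : nat -> C) :
  fourier_expansion h F c ->
  fourier_expansion h (fun z => r * F z) (fun n => r * c n).
Proof.
  intros hF z hz.
  eapply is_series_ext; [|exact (is_series_scal r _ _ (hF z hz))].
  intros n. cbv beta. apply Cmult_assoc.
Qed.

Lemma fourier_unique (h : nat) (F : C -> C) (c d : nat -> C) :
  (0 < h)%nat -> fourier_expansion h F c -> fourier_expansion h F d ->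
  forall n, c n = d n.
Proof.
  intros hh hc hd n.
  assert (e : c n + (-1) * d n = 0).
  { apply (fourier_zero h (fun n => c n + (-1) * d n) hh).
    eapply fourier_ext; [|exact (fourier_plus _ _ _ _ _ hc (fourier_scal _ (-1) _ _ hd))].
    intros z _. cbv beta. ring. }
  replace (d n) with (c n + (-1) * d n + d n) by (rewrite e; ring). ring.
Qed.

(** Here e(r z / h) = e(z / k)^d.  The uses are d = p with r = 1, which
    rewrites an expansion of period 1 as one of period p, and d = p^2 with
    r = p, for the term f(p z) of the Hecke operator: all terms are then
    expansions in the same parameter e(z / p). *)
Lemma fourier_dilate (h k d : nat) (r : R) (F : C -> C) (c : nat -> C) :
  (0 < h)%nat -> (0 < k)%nat -> (0 < d)%nat -> (0 < r)%R ->
  (INR k * r = INR d * INR h)%R ->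
  fourier_expansion h F c ->
  fourier_expansion k (fun z => F (r * z)) (spread (RtoC 0) d c).
Proof.
  intros hh hk hd hr e hF z hz.
  assert (hz' : upper_half_plane (r * z)).
  { unfold upper_half_plane in *. simpl. rewrite Rmult_0_l, Rplus_0_r. now apply Rmult_lt_0_compat. }
  eapply is_series_ext; [|exact (is_series_spread d _ _ hd (hF _ hz'))].
  intros n. unfold spread.
  destruct (Nat.eqb_spec (n mod d) 0) as [e0 | ne].
  - f_equal. rewrite !cis2pi_pow. f_equal.
    assert (en : n = (d * (n / d))%nat) by (pose proof (Nat.div_mod_eq n d); lia).
    rewrite en at 2. rewrite mult_INR, RtoC_mult.
    pose proof (INR_neq0 h hh) as hh0. pose proof (INR_neq0 k hk) as hk0.
    apply (f_equal RtoC) in e. rewrite !RtoC_mult in e.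
    replace (INR d * INR (n / d) * (z / INR k)) with (INR (n / d) * z * (INR d * INR h) / (INR h * INR k)) by now field.
    rewrite <- e. now field.
  - symmetry. apply Cmult_0_l.
Qed.

(** Summing over the translates z + b kills the coefficients of index not
    divisible by p, by orthogonality of the p-th roots of unity. *)
Lemma fourier_translates (p : nat) (F : C -> C) (c : nat -> C) :
  (0 < p)%nat -> fourier_expansion 1 F c ->
  fourier_expansion p (fun z => Csum (seq 0 p) (fun b => F ((z + INR b) / INR p)))
    (fun n => if (n mod p =? 0)%nat then INR p * c n else 0).
Proof.
  intros hp hF z hz. pose proof (INR_neq0 p hp) as hp0.
  eapply is_series_ext; [|apply (is_Cseries_Csum (seq 0 p)
    (fun b n => c n * cis2pi ((z + INR b) / INR p) ^ n))].
  - intros n. cbv beta.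
    rewrite Csum_ext with (G := fun b => c n * cis2pi (z / INR p) ^ n * cis2pi (INR b / INR p) ^ n).
    2:{ intros b. replace ((z + INR b) / INR p) with (z / INR p + INR b / INR p) by now field.
        rewrite cis2pi_plus, Cpow_mult_l. ring. }
    rewrite Csum_scal, Csum_roots_of_unity by easy.
    (* [ring] has to see the carrier C instead of the normed module on it *)
    match goal with |- ?x = ?y => change (@eq C x y) end.
    destruct (n mod p =? 0)%nat; ring.
  - intros b.
    assert (hb : upper_half_plane ((z + INR b) / INR p)).
    { unfold upper_half_plane, Cdiv in *. rewrite <- RtoC_inv.
      2: { intros e. apply hp0. now rewrite e. }
      pose proof (lt_0_INR p hp) as hp'. simpl.
      rewrite Rmult_0_r, Rplus_0_l, Rplus_0_r.
      apply Rmult_lt_0_compat; [exact hz | now apply Rinv_0_lt_compat]. }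
    eapply is_series_ext; [|exact (hF _ hb)].
    intros n. cbv beta. do 2 f_equal. simpl. f_equal. field. apply hp0.
Qed.

Lemma filter_divisors_prime (N p : nat) :
  prime (Z.of_nat p) ->
  filter (fun a => (p mod a =? 0)%nat && (Nat.gcd a N =? 1)%nat)%bool (seq 1 p) =
  if (Nat.gcd p N =? 1)%nat then [1; p]%nat else [1]%nat.
Proof.
  intros hp. pose proof (prime_ge_2 _ hp) as h2.
  replace (seq 1 p) with (1 :: seq 2 (p - 2) ++ [p])%nat.
  2:{ replace p with (S (S (p - 2)))%nat at 3 by lia.
      change (seq 1 (S (S (p - 2)))) with (1 :: seq 2 (S (p - 2)))%nat.
      rewrite seq_S. do 3 f_equal. lia. }
  cbn [filter]. rewrite Nat.mod_1_r.
  change (Nat.gcd 1 N) with 1%nat. cbn [Nat.eqb andb]. rewrite filter_app. cbn [filter].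
  rewrite Nat.Div0.mod_same. cbn [Nat.eqb andb].
  replace (filter _ (seq 2 (p - 2))) with (@nil nat).
  - now destruct (Nat.gcd p N =? 1)%nat.
  - symmetry. rewrite <- (filter_false (seq 2 (p - 2))). apply filter_ext_in. intros a ha. apply in_seq in ha.
    destruct (Nat.eqb_spec (p mod a) 0) as [e|]; [|easy]. exfalso.
    apply Nat.Lcm0.mod_divide in e. destruct e as [k e].
    assert (hd : (Z.of_nat a | Z.of_nat p)%Z) by (exists (Z.of_nat k); lia).
    apply prime_divisors in hd; [lia | easy].
Qed.

Lemma spread_mul {A : Type} (z : A) (d : nat) (u : nat -> A) (m : nat) :
  (0 < d)%nat -> spread z d u (d * m) = u m.
Proof.
  intros hd. unfold spread. rewrite Nat.mul_comm, Nat.Div0.mod_mul, Nat.div_mul by lia.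
  reflexivity.
Qed.

(** * The Hecke operator T_p *)

(** The coefficient of X^2 in the Euler polynomial 1 - a(p) X + ... of f at p,
    which is also the product of the two Satake parameters. *)
Definition satake_product (w N p : nat) : C :=
  if (Nat.gcd p N =? 1)%nat then INR p ^ (w - 1) else 0.

Lemma hecke_prime (w N p : nat) (f : C -> C) (z : C) :
  prime (Z.of_nat p) -> (1 <= w)%nat ->
  hecke w N p f z =
  / INR p * Csum (seq 0 p) (fun b => f ((z + INR b) / INR p)) +
  satake_product w N p * f (INR p * z).
Proof.
  intros hp hw. pose proof (prime_ge_2 _ hp) as h2.
  assert (hp0 : RtoC (INR p) <> 0) by (apply INR_neq0; lia).
  unfold hecke, satake_product. rewrite filter_divisors_prime by easy.
  set (U := Csum (seq 0 p) (fun b => f ((z + INR b) / INR p))).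
  assert (hU : Csum (seq 0 (p / 1)) (fun b => f ((INR 1 * z + INR b) / INR (p / 1)) / INR (p / 1) ^ w)
    = / INR p ^ w * U).
  { unfold U. rewrite Nat.div_1_r, <- Csum_scal. apply Csum_ext. intros b.
    replace (INR 1 * z) with z by (simpl; ring). apply Cmult_comm. }
  assert (hV : Csum (seq 0 (p / p)) (fun b => f ((INR p * z + INR b) / INR (p / p)) / INR (p / p) ^ w)
    = f (INR p * z)).
  { rewrite Nat.div_same by lia. simpl. rewrite Cpow_1_l.
    replace ((INR p * z + 0) / 1) with (INR p * z) by field. field. }
  destruct w as [|w]; [lia|]. simpl Nat.sub. rewrite Nat.sub_0_r.
  assert (hpw : INR p ^ w <> 0) by now apply Cpow_nz.
  destruct (Nat.gcd p N =? 1)%nat; cbn [Csum fold_right]; rewrite hU, ?hV, Cpow_S; field; auto.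
Qed.

Lemma fourier_hecke_prime (w N p : nat) (f : C -> C) (a : nat -> C) :
  prime (Z.of_nat p) -> (1 <= w)%nat -> fourier_expansion 1 f a ->
  fourier_expansion p (hecke w N p f)
    (fun n => (if (n mod p =? 0)%nat then a n else 0) +
              satake_product w N p * spread (RtoC 0) (p * p) a n).
Proof.
  intros hp hw hf. pose proof (prime_ge_2 _ hp) as h2.
  assert (hp0 : RtoC (INR p) <> 0) by (apply INR_neq0; lia).
  apply fourier_ext with (1 := fun z _ => eq_sym (hecke_prime w N p f z hp hw)).
  apply fourier_plus; [|apply fourier_scal].
  - intros z hz.
    eapply is_series_ext;
      [|exact (fourier_scal _ (/ INR p) _ _ (fourier_translates p f a ltac:(lia) hf) z hz)].
    intros n. cbv beta. f_equal. destruct (n mod p =? 0)%nat; [field; exact hp0 | ring].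
  - apply (fourier_dilate 1); try lia; [apply lt_0_INR; lia | | exact hf].
    rewrite mult_INR. simpl. ring.
Qed.

(** Equality of the coefficients of index p m in the expansions of T_p f and
    lambda f with respect to e(z / p). *)
Lemma hecke_relation (w N p : nat) (f : C -> C) (a : nat -> C) (lambda : C) :
  prime (Z.of_nat p) -> (1 <= w)%nat -> fourier_expansion 1 f a ->
  (forall z, upper_half_plane z -> hecke w N p f z = lambda * f z) ->
  forall m, a (p * m)%nat + satake_product w N p * spread (RtoC 0) p a m = lambda * a m.
Proof.
  intros hp hw hf he m. pose proof (prime_ge_2 _ hp) as h2.
  assert (hr : fourier_expansion p (fun z => lambda * f z)
                 (fun n => lambda * spread (RtoC 0) p a n)).
  { apply fourier_scal.
    apply fourier_ext with (F := fun z => f (1 * z)).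
    { intros z _. f_equal. ring. }
    apply (fourier_dilate 1); try lia; [lra | simpl; ring | exact hf]. }
  pose proof (fourier_ext _ _ _ _ he (fourier_hecke_prime w N p f a hp hw hf)) as hl.
  pose proof (fourier_unique p _ _ _ ltac:(lia) hl hr (p * m)) as e. cbv beta in e.
  assert (hm : spread (RtoC 0) (p * p) a (p * m) = spread (RtoC 0) p a m).
  { unfold spread. rewrite Nat.Div0.mul_mod_distr_l, Nat.Div0.div_mul_cancel_l by lia.
    destruct (Nat.eqb_spec (m mod p) 0) as [-> | ne].
    - now rewrite Nat.mul_0_r.
    - destruct (Nat.eqb_spec (p * (m mod p)) 0); [nia | easy]. }
  rewrite hm, spread_mul, Nat.mul_comm, Nat.Div0.mod_mul, Nat.mul_comm in e by lia.
  exact e.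
Qed.

(** The relation at m = 1 identifies the eigenvalue with a(p), and the relations
    at m = p, p^2, p^3 are the usual recursion for a at the powers of p. *)
Lemma coefficient_prime_fourth (w N p : nat) (f : C -> C) (a : nat -> C) :
  prime (Z.of_nat p) -> (1 <= w)%nat -> newform w N f a ->
  let x := satake_product w N p in
  a (p ^ 4)%nat = a p ^ 4 - 3 * a p ^ 2 * x + x * x.
Proof.
  intros hp hw [_ heig hf h1] x. pose proof (prime_ge_2 _ hp) as h2.
  destruct (heig p ltac:(lia)) as [lambda he].
  pose proof (hecke_relation w N p f a lambda hp hw hf he) as hr. fold x in hr.
  assert (hr1 : a p = lambda).
  { pose proof (hr 1%nat) as e. unfold spread in e.
    rewrite Nat.mod_small, Nat.mul_1_r, h1 in e by lia. simpl in e.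
    rewrite <- (Cmult_1_r lambda), <- e. ring. }
  assert (hrS : forall m, a (p * (p * m))%nat = lambda * a (p * m)%nat - x * a m).
  { intros m. pose proof (hr (p * m)%nat) as e. rewrite spread_mul in e by lia.
    rewrite <- e. ring. }
  pose proof (hrS 1%nat) as e2. pose proof (hrS p) as e3.
  pose proof (hrS (p * p)%nat) as e4. rewrite Nat.mul_1_r in e2.
  replace (p ^ 4)%nat with (p * (p * (p * p)))%nat by (simpl; ring).
  rewrite e4, e3, e2, hr1, h1. ring.
Qed.

(** * Fibonacci-type sequences and the norm form *)

Local Open Scope bool_scope.
Local Open Scope Z_scope.

Definition fib_step (s : Z * Z) : Z * Z := (snd s, fst s + snd s).

(** Running the sequence backwards from a pair of nonnegative consecutive terms
    decreases it, until the later term is the smaller one; there the form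
    [s^2 + s t - t^2], whose sign alternates along the sequence, is positive
    and at least s^2, which leaves finitely many pairs (u, v). *)
Lemma fib_descent (l s t : Z) :
  0 < l -> 0 <= s -> 0 <= t -> Z.abs (s * s + s * t - t * t) = l ->
  exists u v n, 0 <= v < u /\ u * u + u * v - v * v = l /\
    (s, t) = Nat.iter n fib_step (u, v).
Proof.
  intros hl hs ht. remember (Z.to_nat (s + 2 * t)) as m eqn:hm.
  revert s t hs ht hm.
  induction m as [m IH] using lt_wf_ind; intros s t hs ht hm e.
  destruct (Z_lt_le_dec t s) as [hts | hst].
  - exists s, t, 0%nat. repeat split; try lia.
    rewrite Z.abs_eq in e; [exact e | nia].
  - assert (t <> 0) by (intros ->; replace s with 0 in e by lia; simpl in e; lia).
    destruct (IH (Z.to_nat (t - s + 2 * s))) with (s := t - s) (t := s)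
      as (u & v & n & h & e' & E); try lia.
    exists u, v, (S n). repeat split; try lia.
    simpl. rewrite <- E. unfold fib_step. simpl. f_equal. lia.
Qed.

(** If y <= x, then y and x - y are consecutive terms, on which the form of
    [fib_descent] takes the value [- (y^2 - 3 y x + x^2)].  The other
    alternative is the symmetry of the form in x and y, which is
    Galois conjugation up to a unit. *)
Lemma norm_form_orbit (l x y : Z) :
  0 < l -> 0 <= x -> 0 <= y -> Z.abs (y * y - 3 * y * x + x * x) = l ->
  exists u v n, 0 <= v < u /\ u * u + u * v - v * v = l /\
    let s := Nat.iter n fib_step (u, v) in
    (fst s = y /\ fst s + snd s = x) \/ (fst s = x /\ fst s + snd s = y).
Proof.
  intros hl hx hy e.
  destruct (Z_le_gt_dec y x) as [h | h].
  - destruct (fib_descent l y (x - y)) as (u & v & n & huv & E & h'); try lia.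
    exists u, v, n. repeat split; try lia. left. simpl. rewrite <- h'. simpl. lia.
  - destruct (fib_descent l x (y - x)) as (u & v & n & huv & E & h'); try lia.
    exists u, v, n. repeat split; try lia. right. simpl. rewrite <- h'. simpl. lia.
Qed.

(** * The congruence sieve *)

Definition power_residues (e r : Z) : list Z :=
  nodup Z.eq_dec (map (fun i => Z.of_nat i ^ e mod r) (seq 0 (Z.to_nat r))).

(** Here and in [compatible], [all_compatible] and [excluded] the branching is
    by [if], because evaluation by value would compute both arguments of
    [&&]. *)
Fixpoint mem (x : Z) (s : list Z) : bool :=
  match s with
  | [] => false
  | y :: s => if x =? y then true else mem x s
  end.

Lemma mem_power_residues (e r c : Z) :
  0 < r -> 0 <= e -> mem (c ^ e mod r) (power_residues e r) = true.
Proof.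
  intros hr he.
  assert (mem_In : forall x s, In x s -> mem x s = true).
  { intros x s; induction s as [|y s IH]; simpl; [easy | intros [-> | h]].
    - now rewrite Z.eqb_refl.
    - rewrite IH by easy. now destruct (x =? y). }
  apply mem_In, nodup_In, in_map_iff. exists (Z.to_nat (c mod r)).
  pose proof (Z.mod_pos_bound c r hr). split.
  - rewrite Z2Nat.id, <- Zpower_mod by lia. easy.
  - apply in_seq. lia.
Qed.

(** The state of the sieve at one modulus: the residues of two consecutive terms
    of the sequence, with the lists of square and q-th power residues. *)
Record track := Track {
  modulus : Z;
  squares : list Z;
  powers : list Z;
  position : Z * Z
}.

(** The lists are bound before the argument [s] so that a partial application
    computes them once for all starting pairs. *)
Definition start (q r : Z) : Z * Z -> track :=
  let sq := power_residues 2 r in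
  let pw := power_residues q r in
  fun s => Track r sq pw (fst s mod r, snd s mod r).

Definition advance (t : track) : track :=
  let (r, sq, pw, s) := t in
  Track r sq pw (snd s, (fst s + snd s) mod r).

(** The two orders in which the terms of index n and n + 2 can be a square and a
    q-th power. *)
Definition compatible (square_first : bool) (t : track) : bool :=
  let (r, sq, pw, s) := t in
  let z := (fst s + snd s) mod r in
  let (y, x) := if square_first then (fst s, z) else (z, fst s) in
  if mem x pw then mem y sq else false.

Fixpoint all_compatible (o : bool) (ts : list track) : bool :=
  match ts with
  | [] => true
  | t :: ts => if compatible o t then all_compatible o ts else false
  end.

Fixpoint excluded (n : nat) (ts : list track) : bool :=
  match n with
  | O => true
  | S n => if all_compatible true ts then false
           else if all_compatible false ts then false
           else excluded n (map advance ts)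
  end.

Definition returns (n : nat) (t : track) : bool :=
  let s := position (Nat.iter n advance t) in
  (fst s =? fst (position t)) && (snd s =? snd (position t)).

Definition bases (l : Z) : list (Z * Z) :=
  (* [u^2 <= u^2 + u v - v^2 = l < 400] bounds [u] by 19 *)
  let range := map Z.of_nat (seq 0 20) in
  filter (fun s => (snd s <? fst s) &&
                   (fst s * fst s + fst s * snd s - snd s * snd s =? l))
         (list_prod range range).

Definition never_compatible (M : nat) (ts : list track) : bool :=
  forallb (returns M) ts && excluded M ts.

Lemma excludedP (M : nat) (ts : list track) :
  excluded M ts = true -> forall n o, (n < M)%nat ->
  exists t, In t ts /\ compatible o (Nat.iter n advance t) = false.
Proof.
  assert (not_all : forall o us, all_compatible o us = false ->
            exists t, In t us /\ compatible o t = false).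
  { intros o us; induction us as [|t us IH]; simpl; [easy|].
    destruct (compatible o t) eqn:E.
    - intros h. destruct (IH h) as (t' & h' & E'). eauto.
    - eauto. }
  revert ts; induction M as [|M IH]; intros ts h n o hn; [lia|].
  simpl in h.
  destruct (all_compatible true ts) eqn:E1; [easy|].
  destruct (all_compatible false ts) eqn:E2; [easy|].
  destruct n as [|n].
  - destruct o; now apply not_all.
  - destruct (IH _ h n o) as (t & ht & E); [lia|].
    apply in_map_iff in ht. destruct ht as (t' & <- & ht').
    exists t'. now rewrite Nat.iter_succ_r.
Qed.

Lemma iter_advance_start q r n s :
  Nat.iter n advance (start q r s) = start q r (Nat.iter n fib_step s).
Proof.
  induction n as [|n IH]; [easy|]. simpl. rewrite IH.
  unfold start, advance, fib_step. simpl. do 2 f_equal.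
  symmetry. apply Zplus_mod.
Qed.

Lemma iter_returns n M t :
  returns M t = true -> Nat.iter (n mod M) advance t = Nat.iter n advance t.
Proof.
  intros h.
  assert (hM : Nat.iter M advance t = t).
  { unfold returns in h. apply andb_prop in h. destruct h as [h1 h2].
    apply Z.eqb_eq in h1, h2.
    assert (keep : let t' := Nat.iter M advance t in
      modulus t' = modulus t /\ squares t' = squares t /\ powers t' = powers t).
    { clear. simpl. induction M as [|M IH]; [easy|]. simpl.
      now destruct (Nat.iter M advance t). }
    simpl in keep. destruct (Nat.iter M advance t) as [r sq pw [c d]], t as [r' sq' pw' [c' d']].
    simpl in *. destruct keep as (-> & -> & ->). congruence. }
  assert (hk : forall k, Nat.iter (M * k) advance t = t).
  { induction k as [|k IH].
    - now rewrite Nat.mul_0_r.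
    - rewrite Nat.mul_succ_r, Nat.iter_add, hM. exact IH. }
  assert (hn : n = (n mod M + M * (n / M))%nat)
    by (pose proof (Nat.div_mod_eq n M); lia).
  transitivity (Nat.iter (n mod M + M * (n / M)) advance t).
  - now rewrite Nat.iter_add, hk.
  - now rewrite <- hn.
Qed.

Lemma never_compatibleP (M : nat) (ts : list track) :
  (0 < M)%nat -> never_compatible M ts = true ->
  forall n o, exists t, In t ts /\ compatible o (Nat.iter n advance t) = false.
Proof.
  intros hM h n o. apply andb_prop in h. destruct h as [hret hex].
  rewrite forallb_forall in hret.
  destruct (excludedP _ _ hex (n mod M) o) as (t & ht & hc).
  { apply Nat.mod_upper_bound. lia. }
  exists t. split; [exact ht|].
  now rewrite <- (iter_returns n M t (hret t ht)).
Qed.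

Lemma bases_complete l u v :
  l < 400 -> 0 <= v < u -> u * u + u * v - v * v = l -> In (u, v) (bases l).
Proof.
  intros hl huv e.
  assert (u < 20) by nia.
  apply filter_In. split.
  - apply in_prod; apply in_map_iff; eexists;
      (split; [apply Z2Nat.id | apply in_seq]); lia.
  - simpl. rewrite (proj2 (Z.eqb_eq _ _) e), Bool.andb_true_r. apply Z.ltb_lt. lia.
Qed.

Lemma start_compatible (q r a b : Z) (o : bool) (s : Z * Z) :
  0 < r -> 0 <= q ->
  (if o then fst s = a ^ 2 /\ fst s + snd s = b ^ q
   else fst s = b ^ q /\ fst s + snd s = a ^ 2) ->
  compatible o (start q r s) = true.
Proof.
  intros hr hq h.
  assert (hb : mem (b ^ q mod r) (power_residues q r) = true)
    by now apply mem_power_residues.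
  assert (ha : mem (a ^ 2 mod r) (power_residues 2 r) = true)
    by now apply mem_power_residues.
  unfold compatible, start. cbn [fst snd]. rewrite <- Zplus_mod.
  destruct o; destruct h as [h1 h2]; rewrite h2, h1, hb; exact ha.
Qed.

(** The index n of [norm_form_orbit] is unbounded, but the state at every modulus
    depends only on n mod M, and the finite check covers all residues. *)
Lemma sieve_excludes (M : nat) (q : Z) (rs : list Z) (l a b : Z) :
  (0 < M)%nat -> 0 <= q -> forallb (Z.ltb 0) rs = true -> 0 < l < 400 -> 0 <= b ->
  forallb (fun s => never_compatible M (map (fun st => st s) (map (start q) rs)))
    (bases l) = true ->
  Z.abs ((a ^ 2) * (a ^ 2) - 3 * a ^ 2 * b ^ q + b ^ q * b ^ q) <> l.
Proof.
  intros hM hq hrs hl hb hs e.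
  destruct (norm_form_orbit l (b ^ q) (a ^ 2)) as (u & v & n & huv & E & h);
    [lia | now apply Z.pow_nonneg | apply Z.pow_even_nonneg; now exists 1 | exact e |].
  rewrite forallb_forall in hrs.
  pose proof (proj1 (forallb_forall _ _) hs (u, v)
    (bases_complete l u v (proj2 hl) huv E)) as hs'.
  assert (key : forall o : bool,
    let s := Nat.iter n fib_step (u, v) in
    (if o then fst s = a ^ 2 /\ fst s + snd s = b ^ q
     else fst s = b ^ q /\ fst s + snd s = a ^ 2) -> False).
  { intros o s ho.
    destruct (never_compatibleP M _ hM hs' n o) as (t & ht & hc).
    rewrite map_map in ht. apply in_map_iff in ht. destruct ht as (r & ht & hr).
    specialize (hrs r hr). apply Z.ltb_lt in hrs.
    rewrite <- ht, iter_advance_start in hc.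
    pose proof (start_compatible q r a b o s hrs hq ho) as hc'. unfold s in hc'. congruence. }
  destruct h as [h | h]; [exact (key true h) | exact (key false h)].
Qed.

(** The sign of the value is the parity of n, so one sieve treats l and -l.  The
    moduli are chosen with small Fibonacci period dividing M; each list has
    some r with r = 1 mod q or r = q^2, for which q-th powers are rare. *)
Lemma quartic_form_avoids (q l a b : Z) :
  In q [11; 13; 17; 19] ->
  In l [31; 59; 61; 79; 101; 139; 149; 151; 179; 191; 199; 19 ^ 2] ->
  0 <= b ->
  Z.abs (a ^ 4 - 3 * a ^ 2 * b ^ q + b ^ q * b ^ q) <> l.
Proof.
  intros hq hl hb.
  set (L := [31; 59; 61; 79; 101; 139; 149; 151; 179; 191; 199; 19 ^ 2]) in hl.
  assert (hb' : 0 < l < 400).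
  { clear - hl. simpl in hl. lia. }
  replace (a ^ 4) with (a ^ 2 * a ^ 2) by ring.
  assert (hq0 : 0 <= q) by (simpl in hq; lia).
  assert (sieved : forall M rs, (0 < M)%nat -> forallb (Z.ltb 0) rs = true ->
    (let starts := map (start q) rs in
     forallb (fun l => forallb (fun s =>
       never_compatible M (map (fun st => st s) starts)) (bases l)) L) = true ->
    Z.abs (a ^ 2 * a ^ 2 - 3 * a ^ 2 * b ^ q + b ^ q * b ^ q) <> l).
  { intros M rs hM hrs h.
    apply (sieve_excludes M q rs l a b hM hq0 hrs hb' hb).
    exact (proj1 (forallb_forall _ _) h l hl). }
  simpl in hq. destruct hq as [<- | [<- | [<- | [<- | []]]]].
  (* 1320 is a multiple of the periods 12, 24, 44, 110 *)
  - apply (sieved 1320%nat [8; 9; 89; 121]); [lia | easy | vm_compute; reflexivity].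
  (* periods 6, 78, 52, 26 *)
  - apply (sieved 312%nat [4; 79; 233; 521]); [lia | easy | vm_compute; reflexivity].
  (* periods 12, 408, 102 *)
  - apply (sieved 408%nat [8; 409; 919]); [lia | easy | vm_compute; reflexivity].
  (* periods 12, 76, 190, 114 *)
  - apply (sieved 2280%nat [8; 113; 191; 229]); [lia | easy | vm_compute; reflexivity].
Qed.

(** * The theorem *)

(** With b = 0 at the primes dividing N, the two cases become one: the Hecke
    recursion then has x = 0. *)
Lemma satake_product_integral (w N p : nat) :
  (2 <= w)%nat ->
  exists b : Z, 0 <= b /\
    satake_product w N p = RtoC (IZR (b ^ Z.of_nat (w - 1))).
Proof.
  intros hw. unfold satake_product. destruct (Nat.gcd p N =? 1)%nat.
  - exists (Z.of_nat p). split; [lia|].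
    now rewrite <- pow_IZR, <- INR_IZR_INZ, RtoC_pow.
  - exists 0. split; [lia|]. now rewrite Z.pow_0_l by lia.
Qed.

Theorem corollary3p4 (k N : nat) (f : C -> C) (a : nat -> Z)
  (hk : In (2 * k)%nat [12; 14; 18; 20]%nat)
  (hN : (1 <= N)%nat)
  (hf : newform (2 * k) N f (fun n => RtoC (IZR (a n))))
  (p : nat) (hp : prime (Z.of_nat p))
  (l : Z)
  (hl : In l [31; 59; 61; 79; 101; 139; 149; 151; 179; 191; 199; 19 ^ 2]%Z) :
  a (p ^ 4)%nat <> l /\ a (p ^ 4)%nat <> (- l)%Z.
Proof.
  assert (hk' : (2 <= 2 * k)%nat /\ In (Z.of_nat (2 * k - 1)) [11; 13; 17; 19]).
  { cbn [In] in hk |- *. lia. }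
  destruct hk' as [hw hq].
  pose proof (coefficient_prime_fourth (2 * k) N p f _ hp ltac:(lia) hf) as e.
  destruct (satake_product_integral (2 * k) N p hw) as (b & hb & hx).
  cbv beta zeta in e. rewrite hx in e.
  pose proof (quartic_form_avoids _ l (a p) b hq hl hb) as h.
  assert (e' : a (p ^ 4)%nat =
    a p ^ 4 - 3 * a p ^ 2 * b ^ Z.of_nat (2 * k - 1)
    + b ^ Z.of_nat (2 * k - 1) * b ^ Z.of_nat (2 * k - 1)).
  { apply eq_IZR, RtoC_inj. rewrite e.
    rewrite plus_IZR, minus_IZR, !mult_IZR, RtoC_plus, RtoC_minus, !RtoC_mult.
    change (a p ^ 4)%Z with (a p ^ Z.of_nat 4)%Z.
    change (a p ^ 2)%Z with (a p ^ Z.of_nat 2)%Z.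
    now rewrite <- !pow_IZR, !RtoC_pow. }
  rewrite <- e' in h.
  assert (hl0 : 0 < l) by (cbn [In] in hl; lia).
  split; intros el; apply h; rewrite el; lia.
Qed.
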